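(* Let $Z<0$, $N\ge2$ and $n\in\{1,\dots,N-1\}$ be fixed. Assume $\omega>\omega_n^*$. Then: (1) If $2n\le N$, or if $2n>N$ with $\omega\ne 2N^2/Z^2$, then $\operatorname{Ker}(\mathcal L_{+,Z})=\{\mathbf 0\}$. (2) If $2n>N$ and $\omega=2N^2/Z^2$, then $\dim(\operatorname{Ker}(\mathcal L_{+,Z}))=N-1$.
   Context: Star graph: $\mathcal G$ consists of $N$ half-lines, each identified with $[L,\infty)$, $L\ge 0$, joined at the vertex $x=L$. Functions are $N$-tuples $(\psi_j)_{j=1}^N$; $L^2(\mathcal G)=\bigoplus_{j=1}^N L^2(L,\infty)$, $H^2(\mathcal G)=\bigoplus_{j=1}^N H^2(L,\infty)$, and $$D(\mathcal H_Z^{\delta'})=\Big\{(\psi_j)\in H^2(\mathcal G):\ \psi_1'(L)=\dots=\psi_N'(L),\ \sum_{j=1}^N\psi_j(L)=Z\psi_1'(L)\Big\}.$$ Profiles: for $\omega>0$, $\Psi_a(x)=\sqrt{2\omega}\,\operatorname{sech}(\sqrt\omega(x-L)+a)$, $x\ge L$. Put $\alpha_n(t)=\frac nt+\frac{N-n}{\sqrt{1-t^2}}$, $t\in(0,1)$, with unique minimizer $t_n^*=\big(\frac{n^{2/3}}{n^{2/3}+(N-n)^{2/3}}\big)^{1/2}$, and $\omega_n^*=\alpha_n(t_n^* )^2/Z^2=(n^{2/3}+(N-n)^{2/3})^3/Z^2$. For $\omega>\omega_n^*$ let $t_1$ be the unique element of $(0,t_n^* )$ with $\alpha_n(t_1)=-Z\sqrt\omega$,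 $t_N=\sqrt{1-t_1^2}$, $a_1=\operatorname{arctanh}t_1$, $a_N=\operatorname{arctanh}t_N$. Operator: $\mathcal L_{+,Z}=\operatorname{diag}(\mathcal L_{+,1},\dots,\mathcal L_{+,1},\mathcal L_{+,N},\dots,\mathcal L_{+,N})$ with $\mathcal L_{+,1}$ repeated $n$ times and $\mathcal L_{+,N}$ repeated $N-n$ times, $\mathcal L_{+,j}=-\partial_x^2+\omega-3\Psi_{a_j}^2$ for $j\in\{1,N\}$, with domain $D(\mathcal L_{+,Z})=D(\mathcal H_Z^{\delta'})$. *)

(* Defs.v *)
From HB Require Import structures.
From mathcomp Require Import all_boot all_order all_algebra.
From mathcomp Require Import all_classical all_reals all_analysis.
From mathcomp Require Import complex.

Set Implicit Arguments.
Unset Strict Implicit.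
Unset Printing Implicit Defensive.

Import Order.TTheory GRing.Theory Num.Theory.
Import numFieldNormedType.Exports.

Local Open Scope classical_set_scope.
Local Open Scope complex_scope.
Local Open Scope ring_scope.

Definition half_line (R : realType) (L : R) : set R := `[L, +oo[%classic.

(* Functions on [L, +oo[ are represented by functions on R whose values on
   ]-oo, L[ are irrelevant; two of them denote the same element of L^2 when
   they agree almost everywhere on the half-line. *)
Definition half_line_ae_eq (R : realType) (L : R) (T : Type) (f g : R -> T) :
    Prop :=
  f = g %[ae (@lebesgue_measure R) in half_line L].

(* L^2(L, +oo): the extension by zero lies in the L^2 space of the line. *)
Definition real_L2 (R : realType) (L : R) (f : R -> R) : Prop :=
  f \_ (half_line L) \in Lfun (@lebesgue_measure R) 2%:E.

(* C^1 functions whose support is a compact subset of ]L, +oo[. *)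
Definition test_function (R : realType) (L : R) (phi : R -> R) : Prop :=
  [/\ forall x, derivable phi x 1,
      continuous (derive1 phi) &
      exists a b : R, L < a /\ forall x, x \notin `[a, b] -> phi x = 0].

Definition real_weak_derivative (R : realType) (L : R) (f df : R -> R) : Prop :=
  forall phi : R -> R, test_function L phi ->
    \int[@lebesgue_measure R]_(x in half_line L) (f x * derive1 phi x) =
    - \int[@lebesgue_measure R]_(x in half_line L) (df x * phi x).

(* The value at the vertex of the continuous representative of f. *)
Definition real_trace (R : realType) (L : R) (f : R -> R) (c : R) : Prop :=
  exists g : R -> R,
    [/\ {within half_line L, continuous g}, half_line_ae_eq L f g & g L = c].

(* Measure and integration theory are real-valued in the library, so the
   complex-valued notions are taken on real and imaginary parts. *)
Definition L2 (R : realType) (L : R) (f : R -> R[i]) : Prop :=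
  real_L2 L (fun x => complex.Re (f x)) /\ real_L2 L (fun x => complex.Im (f x)).

Definition weak_derivative (R : realType) (L : R) (f df : R -> R[i]) : Prop :=
  real_weak_derivative L (fun x => complex.Re (f x)) (fun x => complex.Re (df x)) /\
  real_weak_derivative L (fun x => complex.Im (f x)) (fun x => complex.Im (df x)).

Definition trace (R : realType) (L : R) (f : R -> R[i]) (c : R[i]) : Prop :=
  real_trace L (fun x => complex.Re (f x)) (complex.Re c) /\
  real_trace L (fun x => complex.Im (f x)) (complex.Im c).

(* f lies in H^2(L, +oo), with f' = df and f'' = ddf. *)
Definition H2 (R : realType) (L : R) (f df ddf : R -> R[i]) : Prop :=
  [/\ L2 L f, L2 L df, L2 L ddf, weak_derivative L f df &
      weak_derivative L df ddf].

Definition graph_function (R : realType) (N : nat) : Type := 'I_N -> R -> R[i].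

Definition graph_ae_eq (R : realType) (N : nat) (L : R)
    (psi eta : graph_function R N) : Prop :=
  forall j, half_line_ae_eq L (psi j) (eta j).

Definition graph_zero (R : realType) (N : nat) : graph_function R N :=
  fun _ _ => 0.

(* psi lies in D(H_Z^{delta'}), with psi' = dpsi and psi'' = ddpsi. *)
Definition delta_prime_domain (R : realType) (N : nat) (L Z : R)
    (psi dpsi ddpsi : graph_function R N) : Prop :=
  (forall j, H2 L (psi j) (dpsi j) (ddpsi j)) /\
  exists (v : 'I_N -> R[i]) (d : R[i]),
    [/\ forall j, trace L (psi j) (v j),
        forall j, trace L (dpsi j) d &
        \sum_(j < N) v j = Z%:C * d].

Definition sech (R : realType) (x : R) : R := 2 / (expR x + expR (- x)).

Definition arctanh (R : realType) (t : R) : R := ln ((1 + t) / (1 - t)) / 2.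

Definition profile (R : realType) (L omega a x : R) : R :=
  Num.sqrt (2 * omega) * sech (Num.sqrt omega * (x - L) + a).

Definition alpha (R : realType) (N n : nat) (t : R) : R :=
  n%:R / t + (N - n)%N%:R / Num.sqrt (1 - t ^+ 2).

Definition t_star (R : realType) (N n : nat) : R :=
  Num.sqrt (n%:R `^ (2 / 3) / (n%:R `^ (2 / 3) + (N - n)%N%:R `^ (2 / 3))).

Definition omega_star (R : realType) (N n : nat) (Z : R) : R :=
  alpha N n (t_star R N n) ^+ 2 / Z ^+ 2.

Definition profile_shift (R : realType) (N n : nat) (t1 : R) (j : 'I_N) : R :=
  if (j < n)%N then arctanh t1 else arctanh (Num.sqrt (1 - t1 ^+ 2)).

(* The graph of L_{+,Z}: psi is in the domain and L_{+,Z} psi = eta. *)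
Definition Lplus (R : realType) (N n : nat) (L Z omega t1 : R)
    (psi eta : graph_function R N) : Prop :=
  exists dpsi ddpsi : graph_function R N,
    delta_prime_domain L Z psi dpsi ddpsi /\
    graph_ae_eq L eta (fun j x =>
      - ddpsi j x
      + (omega - 3 * profile L omega (profile_shift n t1 j) x ^+ 2)%:C * psi j x).

Definition Ker_Lplus (R : realType) (N n : nat) (L Z omega t1 : R) :
    set (graph_function R N) :=
  [set psi | Lplus n L Z omega t1 psi (@graph_zero R N)].

(* The zero subspace of L^2(G), as the set of representatives of 0. *)
Definition L2_zero (R : realType) (N : nat) (L : R) :
    set (graph_function R N) :=
  [set psi | (forall j, L2 L (psi j)) /\ graph_ae_eq L psi (@graph_zero R N)].

Definition lincomb (R : realType) (N m : nat) (c : 'I_m -> R[i])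
    (b : 'I_m -> graph_function R N) : graph_function R N :=
  fun j x => \sum_(k < m) c k * b k j x.

(* The complex dimension, modulo almost everywhere equality, of a set V of
   representatives of the elements of a subspace of L^2(G). *)
Definition L2_dim (R : realType) (N : nat) (L : R)
    (V : set (graph_function R N)) (m : nat) : Prop :=
  exists b : 'I_m -> graph_function R N,
    [/\ forall k, V (b k),
        forall c : 'I_m -> R[i],
          graph_ae_eq L (lincomb c b) (@graph_zero R N) -> forall k, c k = 0 &
        forall psi, V psi -> exists c : 'I_m -> R[i],
          graph_ae_eq L psi (lincomb c b)].

(* Main.v *)
(* An element of the kernel restricts on each edge to an L^2 solution of
   psi'' = (omega - 3 Psi_a^2) psi; by du Bois-Reymond's lemma it is a classical
   solution, and its Wronskian with Psi_a' is constant and integrable, hence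
   zero, so that psi = c Psi_a'. With t = tanh a and u = sech a at the vertex,
   the derivative of Psi_a' there is proportional to u (1 - 2 t^2). If
   1 - 2 t1^2 <> 0, the vertex conditions express every coefficient through the
   common derivative, and a nonzero solution requires n t_N^3 = (N - n) t1^3,
   that is t1 = t_n^*, which is excluded. If 1 - 2 t1^2 = 0, that is
   omega = 2 N^2 / Z^2 and 2 n > N, all the Psi_a' coincide and only the
   condition that the coefficients sum to zero remains. *)

Require Import Defs.
From HB Require Import structures.
From mathcomp Require Import all_boot all_order all_algebra.
From mathcomp Require Import all_classical all_reals all_analysis.
From mathcomp Require Import measurable_realfun complex ring lra.

Set Implicit Arguments.
Unset Strict Implicit.
Unset Printing Implicit Defensive.

Import Order.TTheory GRing.Theory Num.Theory.
Import numFieldNormedType.Exports.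

Local Open Scope ring_scope.

(** * Hyperbolic functions and the derivative of the profile *)

(** The hypotheses on [t1] enter through the cube roots p and q of n and N - n: with u = sqrt(1 -
    t1^2), the bound t1 < t_n^* reads q t1 < p u, and the excluded condition reads (q t1)^3 = (p
    u)^3. For every n, [alpha] takes the value sqrt 2 N at 1 / sqrt 2, and this point lies below
    t_n^* exactly when 2 n > N: hence the exceptional frequency and the restriction on n. On the
    analytic side the obstacle is that elements of the domain are known only up to null sets,
    through weak derivatives and through traces of continuous representatives. These representatives
    are extended to continuous functions on the whole line, constant to the left of L, so that du
    Bois-Reymond's lemma is only needed for continuous functions. The Wronskian is integrable
    because each of its two terms is a product of L^2 functions. Division by Psi_a' is legitimate
    because every shift is positive, which keeps Psi_a' away from zero at each point of the
    half-line. Since the potential is real, real and imaginary parts are treated separately. *)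

Definition hyptan (R : realType) (x : R) : R :=
  (expR x - expR (- x)) / (expR x + expR (- x)).

Lemma expRDN_gt0 (R : realType) (x : R) : 0 < expR x + expR (- x).
Proof. by rewrite addr_gt0 ?expR_gt0. Qed.

Lemma sech_gt0 (R : realType) (x : R) : 0 < sech x.
Proof. by rewrite divr_gt0 ?expRDN_gt0. Qed.

Lemma sech2Dhyptan2 (R : realType) (x : R) : sech x ^+ 2 + hyptan x ^+ 2 = 1.
Proof.
have ne0 := lt0r_neq0 (expRDN_gt0 x).
have e1 := expRxMexpNx_1 x.
rewrite /sech /hyptan; move: ne0 e1.
move: (expR x) (expR (- x)) => a b ne0 ab.
have -> : (2 / (a + b)) ^+ 2 + ((a - b) / (a + b)) ^+ 2 =
  (4 * (1 - a * b) + (a + b) ^+ 2) / (a + b) ^+ 2 by field.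
by rewrite ab subrr mulr0 add0r divff// expf_neq0.
Qed.

Lemma sech_le1 (R : realType) (x : R) : sech x <= 1.
Proof.
have := sech2Dhyptan2 x; have := sech_gt0 x; have := sqr_ge0 (hyptan x).
by nra.
Qed.

Lemma hyptan_norm_le1 (R : realType) (x : R) : `|hyptan x| <= 1.
Proof.
move: (sech2Dhyptan2 x) (sqr_ge0 (sech x)) => h1 h2.
by rewrite -(@expr_le1 _ 2)// -normrX ger0_norm ?sqr_ge0//; lra.
Qed.

Lemma hyptan_gt0 (R : realType) (x : R) : 0 < x -> 0 < hyptan x.
Proof.
move=> x0; rewrite divr_gt0 ?expRDN_gt0// subr_gt0 ltr_expR.
by rewrite (lt_trans _ x0)// oppr_lt0.
Qed.

Lemma hyptan_nondecreasing (R : realType) :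
  {homo @hyptan R : x y / x <= y}.
Proof.
move=> x y xy; rewrite /hyptan ler_pdivlMr ?expRDN_gt0// mulrAC.
rewrite ler_pdivrMr ?expRDN_gt0//.
have : expR x * expR (- y) <= expR y * expR (- x).
  by rewrite ler_pM ?expR_ge0// ler_expR// lerN2.
by nra.
Qed.


Lemma is_derive_sech (R : realType) (x : R) :
  is_derive x 1 (@sech R) (- (sech x * hyptan x)).
Proof.
have ne0 := lt0r_neq0 (expRDN_gt0 x).
have dN : is_derive x 1 (fun y : R => expR (- y)) (- expR (- x)).
  have := is_derive1_comp (is_derive_expR (- x)) (is_deriveNid x 1).
  by rewrite mulrN1.
have dV := @is_deriveV _ (expR \+ (fun y : R => expR (- y))) _ _ _ ne0
  (is_deriveD (is_derive_expR x) dN).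
have dM := is_deriveM (is_derive_cst (2 : R) x 1) dV.
apply: (is_derive_eq dM).
by rewrite /sech /hyptan /GRing.scale/= ; field.
Qed.

Lemma is_derive_hyptan (R : realType) (x : R) :
  is_derive x 1 (@hyptan R) (sech x ^+ 2).
Proof.
have ne0 := lt0r_neq0 (expRDN_gt0 x).
have e1 := expRxMexpNx_1 x.
have dN : is_derive x 1 (fun y : R => expR (- y)) (- expR (- x)).
  have := is_derive1_comp (is_derive_expR (- x)) (is_deriveNid x 1).
  by rewrite mulrN1.
have dV := @is_deriveV _ (expR \+ (fun y : R => expR (- y))) _ _ _ ne0
  (is_deriveD (is_derive_expR x) dN).
have dB : is_derive x 1 (expR \- (fun y : R => expR (- y))) _ :=
  is_deriveB (is_derive_expR x) dN.
have dM := is_deriveM dB dV.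
apply: (is_derive_eq dM).
rewrite /sech /GRing.scale/=.
move: ne0 e1; move: (expR x) (expR (- x)) => p q ne0 pq.
have -> : (p - q) * (- (p + q) ^- 2 * (p - q)) + (p + q)^-1 * (p - - q) =
  4 * (p * q) * (p + q) ^- 2 by field.
by rewrite pq; field.
Qed.

Lemma hyptan_arctanh (R : realType) (t : R) : -1 < t < 1 ->
  hyptan (arctanh t) = t.
Proof.
move=> /andP[t1 t2]; rewrite /hyptan; set x := arctanh t.
have r0 : 0 < (1 + t) / (1 - t) by apply: divr_gt0; lra.
have e2 : expR x ^+ 2 = (1 + t) / (1 - t).
  rewrite expr2 -expRD /x /arctanh -splitr lnK//; by rewrite posrE.
have e1 := expRxMexpNx_1 x; have := expRDN_gt0 x.
move: (expR x) (expR (- x)) e1 e2 => p q pq e2 pq0.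
have pq0' : p + q != 0 by rewrite gt_eqF.
have e3 : p ^+ 2 * (1 - t) = 1 + t by rewrite e2 divfK// gt_eqF// subr_gt0.
(* This factor clears the denominator and leaves only p^2 and p q = 1, both known. *)
apply: (@mulIf _ (p * (p + q))).
  rewrite mulf_neq0//; apply: contra_eq_neq pq => ->.
  by rewrite mul0r eq_sym oner_neq0.
have -> : (p - q) / (p + q) * (p * (p + q)) = p ^+ 2 - p * q by field.
have -> : t * (p * (p + q)) = t * p ^+ 2 + t * (p * q) by ring.
by rewrite pq; lra.
Qed.

Lemma sech_arctanh (R : realType) (t : R) : -1 < t < 1 ->
  sech (arctanh t) = Num.sqrt (1 - t ^+ 2).
Proof.
move=> t1; have := sech2Dhyptan2 (arctanh t); rewrite hyptan_arctanh//.
move=> /eqP; rewrite -[_ == _](inj_eq (addIr (- t ^+ 2))) addrK => /eqP <-.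
by rewrite sqrtr_sqr ger0_norm// ltW// sech_gt0.
Qed.

Lemma arctanh_gt0 (R : realType) (t : R) : 0 < t < 1 -> 0 < arctanh t.
Proof.
move=> /andP[t0 t1]; rewrite divr_gt0// ln_gt0//.
by rewrite ltr_pdivlMr; lra.
Qed.

Section kernel_solution.
Context {R : realType}.
Variables (s L a : R).

Let theta (x : R) : R := s * (x - L) + a.

Definition sechv (x : R) := sech (theta x).
Definition hyptanv (x : R) := hyptan (theta x).

Let is_derive_theta (x : R) : is_derive x 1 theta s.
Proof.
have dB := is_deriveB (is_derive_id x 1) (is_derive_cst L x 1).
have dM := is_deriveM (is_derive_cst s x 1) dB.
apply: (is_derive_eq (is_deriveD dM (is_derive_cst a x 1))).
by rewrite /GRing.scale/=; ring.
Qed.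

Lemma is_derive_sechv (x : R) :
  is_derive x 1 sechv (- (s * (sechv x * hyptanv x))).
Proof.
have dS := is_derive1_comp (is_derive_sech (theta x)) (is_derive_theta x).
apply: (is_derive_eq dS).
by rewrite mulrC mulrN.
Qed.

Lemma is_derive_hyptanv (x : R) : is_derive x 1 hyptanv (s * sechv x ^+ 2).
Proof.
have dT := is_derive1_comp (is_derive_hyptan (theta x)) (is_derive_theta x).
apply: (is_derive_eq dT).
by rewrite mulrC.
Qed.

(* Up to a constant factor, the derivative of the profile, which solves the
   linearized equation by translation invariance. *)
Definition sol (x : R) := sechv x * hyptanv x.
Definition dsol (x : R) := s * (sechv x * (2 * sechv x ^+ 2 - 1)).
(** Written as potential times [sol]: for s^2 = omega and Psi_a^2 = 2 omega sech^2, the first two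
    factors are omega - 3 Psi_a^2. *)
Definition ddsol (x : R) := s ^+ 2 * (1 - 6 * sechv x ^+ 2) * sol x.

Let ST x : hyptanv x ^+ 2 = 1 - sechv x ^+ 2.
Proof. by rewrite -(sech2Dhyptan2 (theta x)) /sechv /hyptanv; ring. Qed.

Lemma is_derive_sol (x : R) : is_derive x 1 sol (dsol x).
Proof.
apply: (is_derive_eq (is_deriveM (is_derive_sechv x) (is_derive_hyptanv x))).
rewrite /GRing.scale/= /dsol.
transitivity (s * sechv x * (sechv x ^+ 2 - hyptanv x ^+ 2)); first by ring.
by rewrite ST; ring.
Qed.

Lemma is_derive_dsol (x : R) : is_derive x 1 dsol (ddsol x).
Proof.
have dS := is_derive_sechv x.
have dX := is_deriveB (is_deriveM (is_derive_cst (2 : R) x 1) (is_deriveX 2 dS))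
  (is_derive_cst (1 : R) x 1).
have dM : is_derive x 1 dsol _ :=
  is_deriveM (is_derive_cst s x 1) (is_deriveM dS dX).
apply: (is_derive_eq dM).
rewrite /GRing.scale/= /ddsol /sol !mulr0.
have -> : (cst 2 * sechv ^+ 2 - cst 1) x = 2 * sechv x ^+ 2 - 1 by [].
by ring.
Qed.

End kernel_solution.

(** * Integrals of continuous functions and du Bois-Reymond's lemma *)

Section continuous_integrals.
Context {R : realType}.
Notation mu := (@lebesgue_measure R).
Implicit Types (f g u w : R -> R) (a b x y L : R).

(** Moves the integral of a compactly supported function between the half-line and a segment. *)
Lemma Rintegral_eq_support (D E : set R) f :
  (forall x, f x != 0 -> D x <-> E x) ->
  \int[mu]_(x in D) f x = \int[mu]_(x in E) f x.
Proof.
move=> fDE; rewrite Rintegral_mkcond [RHS]Rintegral_mkcond.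
congr Rintegral; apply/funext => x; rewrite !patchE.
have [->|/fDE DE] := eqVneq (f x) 0; first by rewrite !if_same.
congr (if _ then _ else _); apply/idP/idP; rewrite !inE; by case: DE.
Qed.

Lemma continuous_integrable f a b : continuous f ->
  mu.-integrable `[a, b]%classic (EFin \o f).
Proof.
move=> cf; apply: continuous_compact_integrable; first exact: segment_compact.
exact: continuous_subspaceT.
Qed.

Lemma is_derive_primitive f a x : continuous f -> a < x ->
  is_derive x 1 (fun y => \int[mu]_(t in `[a, y]) f t) (f x).
Proof.
move=> cf ax; have x1 : x < x + 1 by rewrite ltrDl.
have [dF <-] := continuous_FTC1_closed x1 (continuous_integrable a (x + 1) cf)
  ax (cf x).
by rewrite derive1E; exact: derivableP.
Qed.

Lemma is_derive_continuous f df x : is_derive x 1 f df ->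
  {for x, continuous f}.
Proof. by move=> [fx _]; exact/differentiable_continuous/derivable1_diffP. Qed.

Lemma derivable_cc_LRcontinuous f a b : a <= b ->
  (forall x, a <= x <= b -> derivable f x 1) -> derivable_oo_LRcontinuous f a b.
Proof.
move=> ab df; split.
- by move=> x /[!in_itv]/= /andP[ax xb]; apply: df; rewrite !ltW.
- apply: cvg_at_right_filter; apply/differentiable_continuous/derivable1_diffP.
  by apply: df; rewrite lexx.
- apply: cvg_at_left_filter; apply/differentiable_continuous/derivable1_diffP.
  by apply: df; rewrite lexx ab.
Qed.

Lemma Rintegral_cc_parts f df g dg a b : a < b ->
  continuous df -> continuous dg ->
  (forall x, a <= x <= b -> is_derive x 1 f (df x)) ->
  (forall x, a <= x <= b -> is_derive x 1 g (dg x)) ->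
  g a = 0 -> g b = 0 ->
  \int[mu]_(x in `[a, b]) (f x * dg x) = - \int[mu]_(x in `[a, b]) (df x * g x).
Proof.
move=> ab cdf cdg fdf gdg ga gb.
have itvP' x : x \in `]a, b[ -> a <= x <= b.
  by rewrite in_itv/= => /andP[ax xb]; rewrite !ltW.
rewrite (@Rintegration_by_parts _ f g df dg)//.
- by rewrite ga gb !mulr0 subrr sub0r.
- exact: continuous_subspaceT.
- apply: derivable_cc_LRcontinuous; first exact: ltW.
  by move=> x /fdf[].
- by move=> x /itvP' /fdf dfx; rewrite derive1E; exact: derive_val.
- exact: continuous_subspaceT.
- apply: derivable_cc_LRcontinuous; first exact: ltW.
  by move=> x /gdg[].
- by move=> x /itvP' /gdg dfx; rewrite derive1E; exact: derive_val.
Qed.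

(** The primitive of f from a is squeezed between 0 and its value 0 at b, so it vanishes on the
    segment, and its derivative f vanishes inside. *)
Lemma continuous_Rintegral_eq0 f a b : continuous f ->
  (forall x, 0 <= f x) -> \int[mu]_(x in `[a, b]) f x = 0 ->
  forall x, a < x < b -> f x = 0.
Proof.
move=> cf f0 If x /andP[ax xb].
have F0 y : y < b -> \int[mu]_(t in `[a, y]) f t = 0.
  move=> yb; apply/eqP; rewrite eq_le Rintegral_ge0// andbT -If.
  rewrite /Rintegral fine_le//.
  - exact: integrable_fin_num (continuous_integrable _ _ cf).
  - exact: integrable_fin_num (continuous_integrable _ _ cf).
  - apply: ge0_subset_integral => //.
    + by move/integrableP : (continuous_integrable a b cf) => [].
    + by move=> t _; rewrite lee_fin.
    + by apply: subset_itvl; rewrite bnd_simp ltW.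
have := is_derive_primitive cf ax => dF.
have d0 : is_derive x 1 (fun y => \int[mu]_(t in `[a, y]) f t) 0.
  apply: near_eq_is_derive (is_derive_cst (0 : R) x 1).
  near=> y; rewrite F0//; near: y; exact: lt_nbhsl.
by rewrite -(@derive_val _ _ _ _ _ _ _ dF) (@derive_val _ _ _ _ _ _ _ d0).
Unshelve. all: by end_near. Qed.

End continuous_integrals.

Section du_bois_reymond.
Context {R : realType}.
Notation mu := (@lebesgue_measure R).
Implicit Types (f g u w : R -> R) (a b x y L : R).

(** Continuity suffices for this weight: the C^1 test functions are primitives of its products with
    continuous functions. *)
Let bump a b x : R := Num.max 0 ((x - a) * (b - x)).

Let bump_continuous a b : continuous (bump a b).
Proof.
have -> : bump a b = (cst 0 \max (fun x => (x - a) * (b - x))) by [].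
move=> x; apply: continuous_max; first exact: cvg_cst.
by apply: cvgM; apply: cvgB => //; exact: cvg_cst.
Qed.

Let bump_ge0 a b x : 0 <= bump a b x. Proof. by rewrite le_max lexx. Qed.

Let bump_gt0 a b x : a < x < b -> 0 < bump a b x.
Proof. by move=> /andP[ax xb]; rewrite lt_max mulr_gt0 ?orbT ?subr_gt0. Qed.

Let bump_neq0 a b x : a <= b -> bump a b x != 0 -> a < x < b.
Proof.
rewrite /bump; move=> ab; case: (leP ((x - a) * (b - x)) 0) => [|h _].
  by rewrite eqxx.
by apply/andP; split; nra.
Qed.

(* For this c the primitive of (f - c) * bump vanishing at a also vanishes at b,
   so it is a test function. *)
Lemma bump_mean f a b : a < b -> continuous f -> exists c,
  \int[mu]_(x in `[a, b]) ((f x - c) * bump a b x) = 0.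
Proof.
move=> ab cf; set I := \int[mu]_(x in `[a, b]) bump a b x.
have I0 : I != 0.
  apply/eqP => I0; have m : a < (a + b) / 2 < b by rewrite !midf_lt.
  have := continuous_Rintegral_eq0 (@bump_continuous a b) (bump_ge0 a b) I0 m.
  by move/eqP; rewrite gt_eqF// bump_gt0.
exists ((\int[mu]_(x in `[a, b]) (f x * bump a b x)) / I).
set c := (X in X / I).
transitivity (\int[mu]_(x in `[a, b]) (f x * bump a b x - c / I * bump a b x)).
  by apply: eq_Rintegral => x _; rewrite mulrBl.
rewrite RintegralB//; last 2 first.
- apply: (@continuous_integrable _ (fun x => f x * bump a b x)) => x.
  by apply: cvgM; [exact: cf|exact: bump_continuous].
- apply: (@continuous_integrable _ (fun x => c / I * bump a b x)) => x.
  by apply: cvgM; [exact: cvg_cst|exact: bump_continuous].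
rewrite RintegralZl//; last exact: continuous_integrable (@bump_continuous a b).
by rewrite -/c -/I divfK// subrr.
Qed.

(** Let W be a primitive of w. Near x, testing against the primitive of (u - W - c) times a bump
    yields a vanishing integral of (u - W - c)^2 times the bump, so u = c + W there. *)
Lemma du_bois_reymond L u w : continuous u -> continuous w ->
  real_weak_derivative L u w -> forall x, L < x -> is_derive x 1 u (w x).
Proof.
move=> cu cw uw x Lx.
(* The support [a, b] must avoid L; starting the primitives at a0 < a makes them differentiable at a
   as well. *)
pose a := (L + x) / 2; pose b := x + 1; pose a0 := a - 1.
have a0a : a0 < a by rewrite /a0 gtrBl.
have La : L < a by rewrite midf_lt.
have ax : a < x by rewrite midf_lt.
have xb : x < b by rewrite ltrDl.
have ab := lt_trans ax xb.
pose W y := \int[mu]_(t in `[a0, y]) w t.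
have dW y : a0 < y -> is_derive y 1 W (w y).
  by move=> ?; exact: is_derive_primitive.
(* The maximum keeps the argument of W to the right of a0, so U is continuous on the whole line; on
   [a, b] it is u - W. *)
pose U y := u y - W (Num.max a y).
have cU : continuous U.
  move=> y; apply: cvgB; first exact: cu.
  apply: (@continuous_comp _ _ _ (fun y => Num.max a y) W).
    have -> : (fun y => Num.max a y) = (cst a \max id) by [].
    by apply: continuous_max => //; exact: cvg_cst.
  apply/is_derive_continuous/dW.
  by rewrite lt_max a0a.
have [c intU] := bump_mean ab cU.
pose psi y := (U y - c) * bump a b y.
have cpsi : continuous psi.
  move=> y; apply: cvgM; last exact: bump_continuous.
  by apply: cvgB; [exact: cU|exact: cvg_cst].
have psi_supp y : psi y != 0 -> a < y < b.
  by rewrite mulf_eq0 negb_or => /andP[_]; apply/bump_neq0/ltW.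
pose phi y := \int[mu]_(t in `[a0, y]) psi t.
have phi_left y : y <= a -> phi y = 0.
  move=> ya; rewrite -(Rintegral_set0 mu psi); apply: Rintegral_eq_support.
  move=> t /psi_supp /andP[at_ tb]; split => //=; rewrite in_itv/= => /andP[_].
  by rewrite leNgt (le_lt_trans ya).
have phi_right y : b <= y -> phi y = 0.
  move=> yb; rewrite -[RHS]intU; apply: Rintegral_eq_support.
  move=> t /psi_supp /andP[at_ tb]; rewrite /= !in_itv/=.
  by rewrite !ltW//= ?(lt_trans a0a)// (lt_le_trans tb).
have dphi y : is_derive y 1 phi (psi y).
  have [a0y|ya0] := ltP a0 y; first exact: is_derive_primitive.
  have -> : psi y = 0.
    apply/eqP/negPn/negP => /psi_supp /andP[+ _].
    by rewrite ltNge (le_trans ya0)// ltW.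
  apply: near_eq_is_derive (is_derive_cst (0 : R) y 1).
  near=> z; rewrite phi_left// ltW//; near: z; apply: lt_nbhsl.
  exact: le_lt_trans ya0 a0a.
have dphiE : derive1 phi = psi.
  by apply/funext => y; rewrite derive1E; exact: derive_val.
have tphi : test_function L phi.
  split; [by move=> y; case: (dphi y)|by rewrite dphiE|].
  exists a, b; split => // y; rewrite in_itv/= negb_and -!ltNge.
  by move=> /orP[/ltW /phi_left|/ltW /phi_right].
have supp (f : R -> R) : (forall y, f y != 0 -> a <= y <= b) ->
    \int[mu]_(y in half_line L) f y = \int[mu]_(y in `[a, b]) f y.
  move=> fab; apply: Rintegral_eq_support => y /fab yab.
  rewrite /half_line/= !in_itv/= andbT; split => // _.
  by move: yab => /andP[ay _]; rewrite (le_trans _ ay)// ltW.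
(* Both sides equal minus the integral of w phi: the left one by the weak derivative, the right one
   by parts. *)
have : \int[mu]_(y in `[a, b]) (u y * psi y) =
    \int[mu]_(y in `[a, b]) (W y * psi y).
  transitivity (- \int[mu]_(y in `[a, b]) (w y * phi y)).
    have := uw phi tphi; rewrite dphiE supp => [->|]; last first.
      move=> y; rewrite mulf_eq0 negb_or => /andP[_ /psi_supp /andP[? ?]].
      by rewrite !ltW.
    rewrite supp// => y; rewrite mulf_eq0 negb_or => /andP[_].
    apply: contraR; rewrite negb_and -!ltNge.
    by move=> /orP[/ltW /phi_left|/ltW /phi_right] ->.
  symmetry; apply: Rintegral_cc_parts => //.
  - by move=> y /andP[ay _]; apply: dW; exact: lt_le_trans ay.
  - exact: phi_left.
  - exact: phi_right.
have cpsiM f : continuous f ->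
    mu.-integrable `[a, b]%classic (EFin \o (fun y => f y * psi y)).
  move=> cf; apply: continuous_integrable => y.
  by apply: cvgM; [exact: cf|exact: cpsi].
move=> /eqP; rewrite -subr_eq0.
have -> : \int[mu]_(y in `[a, b]) (W y * psi y) =
    \int[mu]_(y in `[a, b]) ((u y - U y) * psi y).
  apply: eq_Rintegral => y; rewrite inE/= in_itv/= => /andP[ay _].
  by rewrite /U max_r// subKr.
rewrite -RintegralB//; [|exact: cpsiM|]; last first.
  apply: (cpsiM (fun y => u y - U y)) => y.
  by apply: cvgB; [exact: cu|exact: cU].
move=> /eqP intUpsi.
(* As psi has integral 0 by the choice of c, U may be replaced by U - c in the vanishing integral of
   U psi. *)
have /continuous_Rintegral_eq0 Uc0 :
    \int[mu]_(y in `[a, b]) ((U y - c) ^+ 2 * bump a b y) = 0.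
  transitivity (\int[mu]_(y in `[a, b]) (U y * psi y - c * psi y)).
    by apply: eq_Rintegral => y _; rewrite /psi; ring.
  rewrite RintegralB//; [|exact: cpsiM|]; last first.
    by apply: (cpsiM (fun=> c)) => y; exact: cvg_cst.
  rewrite RintegralZl//; last exact: continuous_integrable.
  rewrite -[X in c * X]/(\int[mu]_(x in `[a, b]) ((U x - c) * bump a b x)) intU.
  rewrite mulr0 subr0 -[RHS]intUpsi.
  by apply: eq_Rintegral => y _; ring.
have {}Uc0 y : a < y < b -> U y = c.
  move=> yab; have /eqP : (U y - c) ^+ 2 * bump a b y = 0.
    apply: Uc0 => //.
    - move=> z; apply: cvgM; last exact: bump_continuous.
      by apply: cvgM; apply: cvgB;
        [exact: cU|exact: cvg_cst|exact: cU|exact: cvg_cst].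
    - by move=> z; rewrite mulr_ge0 ?sqr_ge0.
  by rewrite mulf_eq0 (gt_eqF (bump_gt0 yab)) orbF sqrf_eq0 subr_eq0 => /eqP.
have dcW : is_derive x 1 (fun y => c + W y) (w x).
  have := is_deriveD (is_derive_cst c x 1) (dW x (lt_trans a0a ax)).
  by rewrite add0r.
apply: near_eq_is_derive dcW.
near=> y.
have yab : a < y < b.
  by apply/andP; split; near: y; [exact: lt_nbhsr|exact: lt_nbhsl].
by rewrite -(Uc0 y yab) /U max_r ?subrK//; case/andP: yab => /ltW.
Unshelve. all: by end_near. Qed.

End du_bois_reymond.

(** * Functions on the half-line *)

Section half_line_functions.
Local Open Scope classical_set_scope.
Context {R : realType}.
Notation mu := (@lebesgue_measure R).
Implicit Types (f g u w : R -> R) (a b c x y L : R).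

Lemma measurable_half_line L : measurable (half_line L).
Proof. exact: measurable_itv. Qed.

Lemma mem_half_line L x : half_line L x = (L <= x) :> Prop.
Proof. by rewrite /half_line/= in_itv/= andbT. Qed.

Lemma is_derive0_half_line L f : (forall x, L < x -> is_derive x 1 f 0) ->
  forall x y, L < x -> L < y -> f x = f y.
Proof.
move=> df x y; wlog xy : x y / x <= y.
  by move=> H; case: (leP x y) => [/H//|/ltW /H Hyx Lx Ly]; rewrite Hyx.
move=> Lx Ly; have dfx z : z \in `[x, y]%R -> is_derive z 1 f 0.
  by rewrite in_itv/= => /andP[xz _]; apply: df; exact: lt_le_trans xz.
have fc : {within `[x, y], continuous f}.
  by apply: derivable_within_continuous => z /dfx [].
have dfo z : z \in `]x, y[%R -> is_derive z 1 f 0.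
  by rewrite in_itv/= => /andP[xz _]; apply: df; exact: lt_trans xz.
have [z _] := @MVT_segment _ f (fun=> 0) x y xy dfo fc.
by rewrite mul0r => /eqP; rewrite subr_eq0 => /eqP.
Qed.

Lemma eq_continuous_half_line L f g : continuous f -> continuous g ->
  (forall x, L < x -> f x = g x) -> forall x, L <= x -> f x = g x.
Proof.
move=> cf cg fg x; rewrite le_eqVlt => /predU1P[<-{x}|]; last exact: fg.
have fL : f y @[y --> L^'+] --> f L by apply: cvg_at_right_filter; exact: cf.
have gL : g y @[y --> L^'+] --> g L by apply: cvg_at_right_filter; exact: cg.
have fgL : f y @[y --> L^'+] --> g L.
  apply: cvg_trans gL; apply: near_eq_cvg; near=> y.
  by rewrite fg//; near: y; exact: nbhs_right_gt.
exact: cvg_unique fL fgL.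
Unshelve. all: by end_near. Qed.

(** A trace only provides continuity within the half-line; freezing the function to the left of L
    gives continuity on the line. *)
Lemma continuous_clamp L f : {within half_line L, continuous f} ->
  continuous (fun x => f (Num.max L x)).
Proof.
move=> /subspace_continuousP cf x.
have LM y : half_line L (Num.max L y) by rewrite mem_half_line le_max lexx.
have cM : continuous (fun y => Num.max L y).
  have -> : (fun y => Num.max L y) = (cst L \max id) by [].
  by move=> y; apply: continuous_max => //; exact: cvg_cst.
have wM : Num.max L y @[y --> x] --> within (half_line L) (nbhs (Num.max L x)).
  move=> B /= wB.
  have nB : \forall y \near x,
    half_line L (Num.max L y) -> B (Num.max L y) := cM x _ wB.
  by apply: filterS nB => y /=; apply.
exact: cvg_comp wM (cf _ (LM x)).
Qed.

Lemma real_L2_measurable L f : real_L2 L f -> measurable_fun (half_line L) f.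
Proof.
rewrite /real_L2 inE => /andP[/[!inE]/= mf _].
by apply/measurable_restrictT => //; exact: measurable_half_line.
Qed.

Lemma continuous_measurable f (D : set R) : continuous f -> measurable_fun D f.
Proof.
by move=> cf; apply: measurable_funTS; exact: continuous_measurable_fun.
Qed.

Lemma ae_half_lineS L (P Q : R -> Prop) : (forall x, L <= x -> P x -> Q x) ->
  (\forall x \ae mu, half_line L x -> P x) ->
  \forall x \ae mu, half_line L x -> Q x.
Proof.
move=> PQ; apply: filterS; first exact: (ae_filter_ringOfSetsType mu).
by move=> x + Lx => /(_ Lx); apply: PQ; rewrite mem_half_line in Lx.
Qed.

Lemma ae_half_lineS2 L (P Q S : R -> Prop) :
  (forall x, L <= x -> P x -> Q x -> S x) ->
  (\forall x \ae mu, half_line L x -> P x) ->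
  (\forall x \ae mu, half_line L x -> Q x) ->
  \forall x \ae mu, half_line L x -> S x.
Proof.
move=> PQS; apply: filterS2; first exact: (ae_filter_ringOfSetsType mu).
move=> x Px Qx Lx; apply: PQS (Px Lx) (Qx Lx).
by rewrite mem_half_line in Lx.
Qed.

Lemma Rintegral_ae_eq L f g : measurable_fun (half_line L) f ->
  measurable_fun (half_line L) g -> half_line_ae_eq L f g ->
  \int[mu]_(x in half_line L) f x = \int[mu]_(x in half_line L) g x.
Proof.
move=> mf mg fg; congr fine; apply: ae_eq_integral.
- exact: measurable_half_line.
- exact/measurable_EFinP.
- exact/measurable_EFinP.
- by apply: ae_half_lineS fg => x _ ->.
Qed.

(** Carries a weak derivative over to continuous representatives; membership in L^2 supplies the
    measurability of the original pair. *)
Lemma weak_derivative_ae L f df g dg :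
  real_L2 L f -> real_L2 L df -> continuous g -> continuous dg ->
  half_line_ae_eq L f g -> half_line_ae_eq L df dg ->
  real_weak_derivative L f df -> real_weak_derivative L g dg.
Proof.
move=> /real_L2_measurable mf /real_L2_measurable mdf
  cg cdg fg dfg fdf phi tphi.
have [dphi cdphi _] := tphi.
have cphi : continuous phi.
  by move=> x; exact/differentiable_continuous/derivable1_diffP.
transitivity (\int[mu]_(x in half_line L) (f x * derive1 phi x)).
  apply: Rintegral_ae_eq.
  - by apply: measurable_funM; exact: continuous_measurable.
  - by apply: measurable_funM => //; exact: continuous_measurable.
  - by apply: ae_half_lineS fg => x _ ->.
rewrite fdf//; congr (- _); apply: Rintegral_ae_eq.
- by apply: measurable_funM => //; exact: continuous_measurable.
- by apply: measurable_funM; exact: continuous_measurable.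
- by apply: ae_half_lineS dfg => x _ ->.
Qed.

End half_line_functions.

(** * Square integrability by domination and weak derivatives of classical functions *)

Section kernel_on_half_line.
Context {R : realType}.
Notation mu := (@lebesgue_measure R).
Implicit Types (f g h u w : R -> R) (x y c C L : R).
Local Open Scope classical_set_scope.

Lemma Lfun2_of_integrable f : measurable_fun setT f ->
  mu.-integrable setT (EFin \o (fun x => f x ^+ 2)) -> f \in Lfun mu 2%:E.
Proof.
move=> mf /integrable_lty if2.
apply/andP; split; rewrite inE//= /finite_norm unlock /=.
apply: poweR_lty; apply: (le_lt_trans _ (if2 measurableT)).
rewrite le_eqVlt; apply/orP; left.
apply/eqP/eq_integral => x _ /=.
by rewrite powR_mulrn// real_normK// num_real.
Qed.

Lemma real_L2_dominated L f g C : continuous f -> continuous g ->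
  mu.-integrable (half_line L) (EFin \o (fun x => g x ^+ 2)) ->
  (forall x, L <= x -> `|f x| <= C * `|g x|) -> real_L2 L f.
Proof.
move=> cf cg ig fg; have mL := measurable_half_line L.
apply: Lfun2_of_integrable.
  have mh : measurable_fun (half_line L) f by exact: continuous_measurable.
  by have := (measurable_restrictT f mL).1 mh; exact.
have -> : EFin \o (fun x => (f \_ (half_line L)) x ^+ 2) =
    (EFin \o (fun x => f x ^+ 2)) \_ (half_line L).
  apply/funext => x; rewrite /= !patchE; case: ifP => //= _.
  by rewrite expr0n.
have mL' : measurable (half_line L : set (measurableTypeR R)) by [].
apply: (integrable_mkcond _ mL').1.
have igC := integrableZl mL' (C ^+ 2) ig.
apply: (le_integrable mL' _ _ igC).
- apply/measurable_EFinP; apply: measurable_funX; exact: continuous_measurable.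
- move=> x; rewrite mem_half_line => /fg fgx.
  rewrite -EFinM !abse_EFin lee_fin normrM. rewrite !normrX -exprMn.
  rewrite lerXn2r ?nnegrE ?mulr_ge0// (le_trans fgx)//.
  by rewrite ler_wpM2r// ler_norm.
Qed.

Lemma weak_derivative_of_derive L f df :
  (forall x, is_derive x 1 f (df x)) -> continuous df ->
  real_weak_derivative L f df.
Proof.
move=> fdf cdf phi [dphi cdphi [a [b [La phi0]]]].
(* Endpoints strictly outside [a, b], where phi vanishes, so that the boundary terms drop; the
   maximum covers the case b < a. *)
pose a' := (L + a) / 2; pose b' := Num.max a b + 1.
have La' : L < a' by rewrite midf_lt.
have a'a : a' < a by rewrite midf_lt.
have bb' : b < b' by rewrite ltr_pwDr// le_max lexx orbT.
have ab' : a < b' by rewrite ltr_pwDr// le_max lexx.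
have phi_out y : y < a \/ b < y -> phi y = 0.
  by move=> yab; apply: phi0; rewrite in_itv/= negb_and -!ltNge; apply/orP.
have dphi_out y : y < a \/ b < y -> derive1 phi y = 0.
  move=> yab; have nab : \forall z \near y, z < a \/ b < z.
    case: yab => yab; first by apply: filterS (lt_nbhsl yab) => z; left.
    by apply: filterS (lt_nbhsr yab) => z; right.
  have : is_derive y 1 phi 0.
    apply: near_eq_is_derive (is_derive_cst (0 : R) y 1).
    by apply: filterS nab => z /phi_out ->.
  by move=> ?; rewrite derive1E; exact: derive_val.
have supp f1 : (forall y, y < a \/ b < y -> f1 y = 0) ->
    \int[mu]_(y in half_line L) f1 y = \int[mu]_(y in `[a', b']) f1 y.
  move=> f10; apply: Rintegral_eq_support => y fy.
  have [ya|ay] := ltP y a; first by rewrite f10 ?eqxx in fy; last by left.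
  have [yb|yb] := ltP b y; first by rewrite f10 ?eqxx in fy; last by right.
  rewrite mem_half_line/= in_itv/=; split=> _.
    by rewrite (le_trans _ ay) ?ltW// (le_lt_trans yb).
  by rewrite (le_trans _ ay)// ltW// (lt_trans La').
rewrite supp; last by move=> y /dphi_out ->; rewrite mulr0.
rewrite supp; last by move=> y /phi_out ->; rewrite mulr0.
apply: Rintegral_cc_parts => //.
- exact: lt_trans ab'.
- by move=> x _; rewrite derive1E; exact: derivableP.
- by apply: phi_out; left.
- by apply: phi_out; right.
Qed.

Lemma real_trace_continuous L f : continuous f -> real_trace L f (f L).
Proof.
move=> cf; exists f; split => //; first exact: continuous_subspaceT.
by apply: aeW.
Qed.

Lemma integrable_cst_half_line L c :
  mu.-integrable (half_line L) (EFin \o cst c) -> c = 0.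
Proof.
have muL : mu (half_line L) = +oo%E.
  by rewrite /half_line lebesgue_measure_itv/= ltry.
have mL : measurable (half_line L : set (measurableTypeR R)).
  exact: measurable_half_line.
move=> /integrableP[_]; apply: contraPP => /eqP c0.
rewrite (@integral_cst _ _ _ mu _ mL `|c|%:E).
by rewrite [X in (_ * X)%E]muL gt0_muley// lte_fin normr_gt0.
Qed.

End kernel_on_half_line.

(** * The equation on one edge *)

Section kernel_equation.
Context {R : realType}.
Notation mu := (@lebesgue_measure R).
Local Open Scope classical_set_scope.
Variables (s L a : R).
Hypotheses (s0 : 0 < s) (a0 : 0 < a).

Notation sech := (sechv s L a).
Notation tanh := (hyptanv s L a).
Notation sol := (sol s L a).
Notation dsol := (dsol s L a).
Notation ddsol := (ddsol s L a).

Lemma continuous_sech : continuous sech.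
Proof. by move=> x; exact: is_derive_continuous (is_derive_sechv s L a x). Qed.

Lemma continuous_sol : continuous sol.
Proof. by move=> x; exact: is_derive_continuous (is_derive_sol s L a x). Qed.

Lemma continuous_dsol : continuous dsol.
Proof. by move=> x; exact: is_derive_continuous (is_derive_dsol s L a x). Qed.

Let pot (x : R) := s ^+ 2 * (1 - 6 * sech x ^+ 2).

Let continuous_pot : continuous pot.
Proof.
move=> x; apply: cvgM; first exact: cvg_cst.
apply: cvgB; first exact: cvg_cst.
apply: cvgM; first exact: cvg_cst.
by apply: cvgM; exact: continuous_sech.
Qed.

Lemma continuous_ddsol : continuous ddsol.
Proof.
by move=> x; apply: cvgM; [exact: continuous_pot|exact: continuous_sol].
Qed.

(** The primitive tanh / s is nondecreasing and bounded, so it has a finite limit at infinity. *)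
Lemma integrable_sech2 :
  mu.-integrable (half_line L) (EFin \o (fun x => sech x ^+ 2)).
Proof.
have mL : measurable (half_line L : set (measurableTypeR R)).
  exact: measurable_half_line.
have cS2 : continuous (fun x => sech x ^+ 2).
  by move=> x; apply: cvgM; exact: continuous_sech.
have dF (x : R) : is_derive x 1 (fun y => s^-1 * tanh y) (sech x ^+ 2).
  have dT := is_derive_hyptanv s L a x.
  apply: (is_derive_eq (is_deriveM (is_derive_cst s^-1 x 1) dT)).
  by rewrite /GRing.scale/= mulr0 addr0 mulKf// gt_eqF.
have cF (x : R) : {for x, continuous (fun y => s^-1 * tanh y)}.
  exact: is_derive_continuous (dF x).
have [l Fl] : exists l : R, s^-1 * tanh x @[x --> +oo%R] --> l.
  exists (sup (range (fun y => s^-1 * tanh y))); apply: nondecreasing_cvgr.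
    move=> x y xy; rewrite ler_wpM2l ?invr_ge0 ?(ltW s0)//.
    by apply: hyptan_nondecreasing; rewrite lerD2r ler_wpM2l ?lerB// (ltW s0).
  exists s^-1 => _ [y _ <-].
  rewrite ler_piMr ?invr_ge0 ?(ltW s0)//.
  by rewrite (le_trans (ler_norm _))// hyptan_norm_le1.
apply/integrableP; split.
  by apply/measurable_EFinP; exact: continuous_measurable.
under eq_integral do rewrite /= ger0_norm ?sqr_ge0//.
rewrite (ge0_continuous_FTC2y (F := fun y => s^-1 * tanh y) (l := l)) ?ltry//.
- by move=> x _; exact: sqr_ge0.
- exact: continuous_subspaceT.
- by apply: cvg_at_right_filter; exact: cF.
- by move=> x _; rewrite derive1E; exact: (@derive_val _ _ _ _ _ _ _ (dF x)).
Qed.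

Let sech01 x : 0 <= sech x <= 1.
Proof. by rewrite ltW ?sech_gt0//= sech_le1. Qed.

Lemma sol_le x : `|sol x| <= 1 * `|sech x|.
Proof.
by rewrite mul1r normrM ler_piMr// hyptan_norm_le1.
Qed.

Let sech2_01 x : 0 <= sech x ^+ 2 <= 1.
Proof. by rewrite sqr_ge0 expr_le1//; case/andP: (sech01 x). Qed.

Lemma real_L2_sol : real_L2 L sol.
Proof.
apply: (real_L2_dominated continuous_sol continuous_sech integrable_sech2).
by move=> x _; exact: sol_le.
Qed.

Lemma real_L2_dsol : real_L2 L dsol.
Proof.
apply: (real_L2_dominated (C := s) continuous_dsol continuous_sech
  integrable_sech2).
move=> x _; rewrite normrM (gtr0_norm s0) ler_wpM2l ?(ltW s0)//.
rewrite normrM ler_piMr//.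
by rewrite ler_norml; move: (sech2_01 x) => /andP[? ?]; apply/andP; split; lra.
Qed.

Lemma real_L2_ddsol : real_L2 L ddsol.
Proof.
(* The constant 5 comes from 1 - 6 sech^2, which lies in [-5, 1]. *)
apply: (real_L2_dominated (C := 5 * s ^+ 2) continuous_ddsol continuous_sech
  integrable_sech2).
move=> x _; rewrite normrM ler_pM//; last by have := sol_le x; rewrite mul1r.
rewrite normrM ger0_norm ?sqr_ge0// mulrC ler_wpM2r ?sqr_ge0//.
by rewrite ler_norml; move: (sech2_01 x) => /andP[? ?]; apply/andP; split; lra.
Qed.

(** With a > 0 the argument of tanh stays positive: the maximum of the profile would lie to the left
    of the vertex. *)
Lemma sol_gt0 x : L <= x -> 0 < sol x.
Proof.
move=> Lx; rewrite mulr_gt0 ?sech_gt0// hyptan_gt0//.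
by rewrite ltr_wpDl// mulr_ge0 ?subr_ge0// ltW.
Qed.

(* The Wronskian of an L^2 solution and sol is constant and integrable on the
   half-line, hence zero. *)
Lemma kernel_equation_L2 (g h : R -> R) : continuous g -> continuous h ->
  (forall x, L < x -> is_derive x 1 g (h x)) ->
  (forall x, L < x -> is_derive x 1 h (pot x * g x)) ->
  mu.-integrable (half_line L)
    (EFin \o (fun x => g x * dsol x - h x * sol x)) ->
  exists c, forall x, L <= x -> g x = c * sol x /\ h x = c * dsol x.
Proof.
move=> cg ch dg dh iW.
set W := fun x => g x * dsol x - h x * sol x in iW.
have cW : continuous W.
  by move=> x; apply: cvgB; apply: cvgM; [exact: cg|exact: continuous_dsol|
    exact: ch|exact: continuous_sol].
have dW x : L < x -> is_derive x 1 W 0.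
  move=> Lx.
  have d1 := is_deriveM (dg x Lx) (is_derive_dsol s L a x).
  have d2 := is_deriveM (dh x Lx) (is_derive_sol s L a x).
  apply: (is_derive_eq (is_deriveB d1 d2)).
  by rewrite /GRing.scale/= /pot /ddsol; ring.
have L1 : L < L + 1 by rewrite ltrDl.
have Wcst x : L <= x -> W x = W (L + 1).
  apply: (eq_continuous_half_line cW (g := fun=> W (L + 1))).
    by move=> y; exact: cvg_cst.
  by move=> y Ly; exact: (is_derive0_half_line dW).
have W0 : W (L + 1) = 0.
  apply: (@integrable_cst_half_line _ L); apply: eq_integrable iW.
    exact: measurable_half_line.
  by move=> x; rewrite inE mem_half_line => Lx; rewrite /= Wcst.
have {}Wcst x : L <= x -> g x * dsol x = h x * sol x.
  by move=> /Wcst; rewrite W0 => /eqP; rewrite subr_eq0 => /eqP.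
(* The derivative of this quotient has the Wronskian, up to sign, as numerator. *)
pose q x := g x / sol x.
have dq x : L < x -> is_derive x 1 q 0.
  move=> Lx; have sx : sol x != 0 by rewrite gt_eqF// sol_gt0// ltW.
  have dV := is_deriveV sx (is_derive_sol s L a x).
  apply: (is_derive_eq (is_deriveM (dg x Lx) dV)).
  rewrite /GRing.scale/=.
  transitivity ((h x * sol x - g x * dsol x) / sol x ^+ 2); first by field.
  by rewrite Wcst ?subrr ?mul0r// ltW.
pose c := q (L + 1); exists c.
have gE x : L <= x -> g x = c * sol x.
  apply: (eq_continuous_half_line cg (g := fun y => c * sol y)).
    by move=> y; apply: cvgM; [exact: cvg_cst|exact: continuous_sol].
  move=> y Ly; rewrite /c (is_derive0_half_line dq L1 Ly) /q divfK//.
  by rewrite gt_eqF// sol_gt0// ltW.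
move=> x Lx; split; first exact: gE.
(* The vanishing Wronskian gives h pointwise, including at L, where no derivative of g is
   available. *)
apply: (@mulIf _ (sol x)); first by rewrite gt_eqF// sol_gt0.
by rewrite -Wcst// gE// mulrAC.
Qed.

End kernel_equation.

(** * From weak L^2 solutions on an edge to multiples of the explicit solution *)

Section kernel_component.
Context {R : realType}.
Notation mu := (@lebesgue_measure R).
Local Open Scope classical_set_scope.
Implicit Types (f g u w : R -> R) (L s a : R).

Lemma real_L2_mul_integrable L f g : real_L2 L f -> real_L2 L g ->
  mu.-integrable (half_line L) (EFin \o (fun x => f x * g x)).
Proof.
move=> fL gL.
have mL : measurable (half_line L : set (measurableTypeR R)).
  exact: measurable_half_line.
have /Lfun1_integrable := Lfun2_mul_Lfun1 fL gL => ifg.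
apply/(integrable_mkcond _ mL); apply: eq_integrable ifg => // x _.
by rewrite /= !patchE; case: ifP; rewrite ?mulr0.
Qed.

Lemma integrable_ae_eq L f g :
  mu.-integrable (half_line L) (EFin \o f) -> continuous g ->
  half_line_ae_eq L f g -> mu.-integrable (half_line L) (EFin \o g).
Proof.
move=> /integrableP[mf intf] cg fg.
have mL : measurable (half_line L : set (measurableTypeR R)).
  exact: measurable_half_line.
have mg : measurable_fun (half_line L : set (measurableTypeR R)) (EFin \o g).
  by apply/measurable_EFinP; exact: continuous_measurable.
apply/integrableP; split => //; apply: le_lt_trans intf.
rewrite le_eqVlt; apply/orP; left; apply/eqP; apply: ae_eq_integral => //.
- exact: measurableT_comp.
- exact: measurableT_comp.
- by apply: ae_half_lineS fg => x _ /= ->.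
Qed.

(** The traces provide continuous representatives of f and df, and the equation itself provides one
    of ddf, so du Bois-Reymond's lemma applies twice. *)
Lemma kernel_component L s a f df ddf v d : 0 < s -> 0 < a ->
  real_L2 L f -> real_L2 L df -> real_L2 L ddf ->
  real_weak_derivative L f df -> real_weak_derivative L df ddf ->
  half_line_ae_eq L ddf
    (fun x => s ^+ 2 * (1 - 6 * sechv s L a x ^+ 2) * f x) ->
  real_trace L f v -> real_trace L df d ->
  exists c, [/\ half_line_ae_eq L f (fun x => c * sol s L a x),
    v = c * sol s L a L & d = c * dsol s L a L].
Proof.
move=> s0 a0 fL dfL ddfL wf wdf eqf [g0 [cg0 fg0 <-]] [h0 [ch0 fh0 <-]].
pose g x := g0 (Num.max L x); pose h x := h0 (Num.max L x).
have cg : continuous g by exact: continuous_clamp.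
have ch : continuous h by exact: continuous_clamp.
have fg : half_line_ae_eq L f g.
  by apply: ae_half_lineS fg0 => x Lx ->; rewrite /g max_r.
have fh : half_line_ae_eq L df h.
  by apply: ae_half_lineS fh0 => x Lx ->; rewrite /h max_r.
pose ddg x := s ^+ 2 * (1 - 6 * sechv s L a x ^+ 2) * g x.
have cddg : continuous ddg.
  have cS : continuous (sechv s L a) by exact: continuous_sech.
  move=> x; apply: cvgM; last exact: cg.
  apply: cvgM; first exact: cvg_cst.
  apply: cvgB; first exact: cvg_cst.
  apply: cvgM; first exact: cvg_cst.
  by apply: cvgM; exact: cS.
have fddg : half_line_ae_eq L ddf ddg.
  by apply: ae_half_lineS2 eqf fg => x _ -> ->.
have dg := du_bois_reymond cg ch (weak_derivative_ae fL dfL cg ch fg fh wf).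
have dh := du_bois_reymond ch cddg
  (weak_derivative_ae dfL ddfL ch cddg fh fddg wdf).
have csol : continuous (sol s L a) by exact: continuous_sol.
have cdsol : continuous (dsol s L a) by exact: continuous_dsol.
(* Membership in L^2 is known for f and df, so integrability is shown for their Wronskian and
   transferred along almost everywhere equality. *)
have iW : mu.-integrable (half_line L)
    (EFin \o (fun x => g x * dsol s L a x - h x * sol s L a x)).
  apply: (@integrable_ae_eq _
    (fun x => f x * dsol s L a x - df x * sol s L a x)).
  - have mL : measurable (half_line L : set (measurableTypeR R)).
      exact: measurable_half_line.
    have i1 := real_L2_mul_integrable fL (real_L2_dsol L a s0).
    have i2 := real_L2_mul_integrable dfL (real_L2_sol L a s0).
    by apply: eq_integrable (integrableB mL i1 i2) => // x _; rewrite /= EFinB.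
  - by move=> x; apply: cvgB; apply: cvgM; [exact: cg|exact: cdsol|exact: ch|
      exact: csol].
  - by apply: ae_half_lineS2 fg fh => x _ -> ->.
have [c ghE] := kernel_equation_L2 s0 a0 cg ch dg dh iW.
have [gL hL] := ghE L (lexx L).
exists c; split.
- by apply: ae_half_lineS fg => x /ghE[<- _] ->.
- by rewrite -gL /g max_l.
- by rewrite -hL /h max_l.
Qed.

End kernel_component.

(** * Vertex conditions *)

Section star_constants.
Context {R : realType}.
Variables (N n : nat).
Hypotheses (hn : (1 <= n <= N - 1)%N).

(** Cube roots turn the powers 2/3 in t_n^* into squares, so that the vertex conditions become
    polynomial. *)
Lemma cube_root_nat (k : nat) : (0 < k)%N -> exists p : R,
  [/\ 0 < p, k%:R = p ^+ 3 & k%:R `^ (2 / 3) = p ^+ 2].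
Proof.
move=> k0; have k0' : 0 < k%:R :> R by rewrite ltr0n.
exists (k%:R `^ 3^-1); split; first exact: powR_gt0.
- by rewrite -powR_mulrn ?powR_ge0// -powRrM mulVf// powRr1 ?ltW.
- by rewrite -powR_mulrn ?powR_ge0// -powRrM mulrC.
Qed.

(** Squared, the bound says t^2 (p^2 + q^2) < p^2, that is q^2 t^2 < p^2 (1 - t^2). *)
Lemma t_star_lt (t : R) : 0 < t < t_star R N n ->
  exists p q u : R, [/\ [/\ 0 < p, 0 < q & 0 < u],
    n%:R = p ^+ 3, (N - n)%N%:R = q ^+ 3,
    Num.sqrt (1 - t ^+ 2) = u & t ^+ 2 + u ^+ 2 = 1 /\ q * t < p * u].
Proof.
move=> /andP[t0].
have n0 : (0 < n)%N by case/andP: hn.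
have m0 : (0 < N - n)%N.
  case/andP: hn => n1 nN; have N0 := leq_trans (leq_trans n1 nN) (leq_subr _ _).
  by rewrite subn_gt0 (leq_ltn_trans nN)// subn1 ltn_predL.
have [p [p0 np npE]] := cube_root_nat n0.
have [q [q0 mq mqE]] := cube_root_nat m0.
rewrite /t_star npE mqE => tlt.
have d0 : 0 < p ^+ 2 + q ^+ 2 by rewrite addr_gt0// exprn_gt0.
have t2 : t ^+ 2 < p ^+ 2 / (p ^+ 2 + q ^+ 2).
  rewrite -[ltRHS]sqr_sqrtr ?divr_ge0 ?sqr_ge0 ?(ltW d0)//.
  by rewrite ltrXn2r ?nnegrE ?sqrtr_ge0 ?(ltW t0).
rewrite ltr_pdivlMr// in t2.
have t1 : 0 < 1 - t ^+ 2.
  by have := exprn_gt0 2 q0; have := exprn_gt0 2 p0; nra.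
exists p, q, (Num.sqrt (1 - t ^+ 2)); split => //.
  by split => //; rewrite sqrtr_gt0.
rewrite sqr_sqrtr ?(ltW t1)//; split; first by rewrite subrKC.
rewrite -(@ltr_pXn2r _ 2)// ?nnegrE ?mulr_ge0 ?sqrtr_ge0 ?ltW// !exprMn.
by rewrite sqr_sqrtr ?(ltW t1)//; lra.
Qed.

End star_constants.

(** * Algebraic consequences of q t < p u *)

Section star_algebra.
Context {R : realType}.
Variables (p q t u : R).
Hypotheses (p0 : 0 < p) (q0 : 0 < q) (t0 : 0 < t) (u0 : 0 < u).
Hypotheses (tu : t ^+ 2 + u ^+ 2 = 1) (qt : q * t < p * u).

(** Equality is the solvability condition for a nonzero common derivative. Multiplied by t u, with 1
    - 2 t^2 = u^2 - t^2, the difference of its sides collapses to (q t)^3 - (p u)^3. *)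
Lemma vertex_condition_neq (X : R) : p ^+ 3 / t + q ^+ 3 / u = X ->
  - X * (1 - 2 * t ^+ 2) != p ^+ 3 * t - q ^+ 3 * u.
Proof.
move=> <-; apply/eqP => e.
have /eqP : (q * t) ^+ 3 = (p * u) ^+ 3.
  apply/eqP; rewrite -subr_eq0; apply/eqP.
  transitivity (t * u * (- (p ^+ 3 / t + q ^+ 3 / u) * (1 - 2 * t ^+ 2) -
    (p ^+ 3 * t - q ^+ 3 * u))); last by rewrite e subrr mulr0.
  have -> : 1 - 2 * t ^+ 2 = u ^+ 2 - t ^+ 2 by move: tu; lra.
  by field; rewrite !gt_eqF.
apply/negP; rewrite lt_eqF// ltrXn2r ?nnegrE ?mulr_ge0// ?ltW//.
Qed.

(* In the variables v = k t and w = k u the equation is p^3 / v + q^3 / w =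
   p^3 + q^3 on the circle v^2 + w^2 = 2, which has the solution v = w = 1. *)
Lemma alpha_eq_midpoint (X : R) : q < p -> p ^+ 3 / t + q ^+ 3 / u = X ->
  X ^+ 2 = 2 * (p ^+ 3 + q ^+ 3) ^+ 2 -> 2 * t ^+ 2 = 1.
Proof.
move=> qp XE X2.
pose k := Num.sqrt (2 : R).
have k0 : 0 < k by rewrite sqrtr_gt0.
have k2 : k ^+ 2 = 2 by rewrite sqr_sqrtr.
have p3 := exprn_gt0 3 p0; have q3 := exprn_gt0 3 q0.
have Xk : X = k * (p ^+ 3 + q ^+ 3).
  apply/eqP; rewrite -(@eqrXn2 _ 2)//; last 2 first.
  - by rewrite -XE addr_ge0// divr_ge0// ltW.
  - by rewrite mulr_ge0 ?addr_ge0// ltW.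
  by rewrite exprMn k2 X2.
pose v := k * t; pose w := k * u.
have v0 : 0 < v by rewrite mulr_gt0.
have w0 : 0 < w by rewrite mulr_gt0.
have vw : v ^+ 2 + w ^+ 2 = 2 by rewrite !exprMn -mulrDr tu mulr1.
have qv : q * v < p * w by rewrite /v /w !(mulrCA _ k) ltr_pM2l.
have e : p ^+ 3 / v + q ^+ 3 / w = p ^+ 3 + q ^+ 3.
  apply: (@mulfI _ k); first by rewrite gt_eqF.
  rewrite -Xk -XE /v /w; field.
  by rewrite !gt_eqF.
suff v1 : v = 1 by rewrite -k2 -exprMn -/v v1 expr1n.
apply/eqP/negPn/negP => v1.
(* The equation and the circle, [e1] and [e2], both relate 1 - v to w - 1; eliminating these factors
   when v differs from 1 gives [e3]. *)
have e1 : (1 - v) * (p ^+ 3 * w) = (w - 1) * (q ^+ 3 * v).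
  apply/eqP; rewrite -subr_eq0; apply/eqP.
  transitivity (v * w * (p ^+ 3 / v + q ^+ 3 / w - (p ^+ 3 + q ^+ 3))).
    by field; rewrite !gt_eqF.
  by rewrite e subrr mulr0.
have e2 : (1 - v) * (1 + v) = (w - 1) * (1 + w) by lra.
have e3 : p ^+ 3 * w * (1 + w) = q ^+ 3 * v * (1 + v).
  apply: (@mulfI _ (1 - v)); first by rewrite subr_eq0 eq_sym.
  transitivity ((1 - v) * (p ^+ 3 * w) * (1 + w)); first by ring.
  rewrite e1; transitivity (q ^+ 3 * v * ((w - 1) * (1 + w))); first by ring.
  by rewrite -e2; ring.
(* Rewritten in q and q v, respectively p and p w, both sides are the same increasing expression, so
   q < p and q v < p w compare them. *)
have : q ^+ 3 * v * (1 + v) < p ^+ 3 * w * (1 + w).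
  have -> : q ^+ 3 * v * (1 + v) = (q * v) * (q ^+ 2 + q * (q * v)) by ring.
  have -> : p ^+ 3 * w * (1 + w) = (p * w) * (p ^+ 2 + p * (p * w)) by ring.
  have qv0 : 0 < q * v by rewrite mulr_gt0.
  rewrite ltr_pM ?(ltW qv0)//.
    by rewrite addr_ge0 ?sqr_ge0// mulr_ge0// ltW.
  rewrite ltrD// ?ltrXn2r ?nnegrE ?ltW//.
  by rewrite ltr_pM// ltW.
by rewrite e3 ltxx.
Qed.

End star_algebra.

Lemma sum_if_ltn (V : nmodType) (N n : nat) (x y : V) : (n <= N)%N ->
  \sum_(j < N) (if (j < n)%N then x else y) = x *+ n + y *+ (N - n).
Proof.
move=> /subnKC; move: (N - n)%N => m <-; rewrite big_split_ord /=.
rewrite (eq_bigr (fun=> x)); last by move=> i _; rewrite ltn_ord.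
rewrite [X in _ + X](eq_bigr (fun=> y)); last first.
  by move=> i _; rewrite ltnNge leq_addr.
by rewrite !sumr_const !card_ord.
Qed.

(** * The kernel on the star graph *)

Section star_kernel.
Context {R : realType}.
Notation mu := (@lebesgue_measure R).
Variables (N n : nat) (L Z omega t1 : R).
Hypotheses (omega0 : 0 < omega) (t1_01 : 0 < t1 < 1).
Local Open Scope classical_set_scope.
Local Open Scope complex_scope.

Let s := Num.sqrt omega.
Let u := Num.sqrt (1 - t1 ^+ 2).
Let shift (j : 'I_N) := profile_shift n t1 j.

Let s0 : 0 < s. Proof. by rewrite sqrtr_gt0. Qed.

Let t2_01 : 0 < 1 - t1 ^+ 2.
Proof. by move/andP: t1_01 => [? ?]; nra. Qed.

Let u0 : 0 < u. Proof. by rewrite sqrtr_gt0. Qed.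

Let u2 : u ^+ 2 = 1 - t1 ^+ 2. Proof. by rewrite sqr_sqrtr// ltW. Qed.

Let u_01 : 0 < u < 1.
Proof. by rewrite u0 /=; move/andP: t1_01 => [? ?]; move: u2 u0; nra. Qed.

Lemma profile_shift_gt0 j : 0 < shift j.
Proof.
by rewrite /shift /profile_shift; case: ifP => _; exact: arctanh_gt0.
Qed.

Let sechv_vertex j : sechv s L (shift j) L = if (j < n)%N then u else t1.
Proof.
rewrite /sechv subrr mulr0 add0r /shift /profile_shift.
move/andP: t1_01 => [t1_0 t1_1]; move/andP: u_01 => [_ u1].
case: ifP => _;
  rewrite sech_arctanh ?(lt_trans _ t1_0) ?(lt_trans _ u0) ?oppr_lt0//.
by rewrite -/u u2 subKr sqrtr_sqr gtr0_norm.
Qed.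

Let hyptanv_vertex j : hyptanv s L (shift j) L = if (j < n)%N then t1 else u.
Proof.
rewrite /hyptanv subrr mulr0 add0r /shift /profile_shift.
move/andP: t1_01 => [t1_0 t1_1]; move/andP: u_01 => [_ u1].
by case: ifP => _;
  rewrite hyptan_arctanh ?(lt_trans _ t1_0) ?(lt_trans _ u0) ?oppr_lt0.
Qed.

(** The two kinds of edge exchange the vertex values of sech and tanh, which leaves their product
    unchanged. *)
Lemma sol_vertex j : sol s L (shift j) L = t1 * u.
Proof.
by rewrite /sol sechv_vertex hyptanv_vertex; case: ifP => _ //; rewrite mulrC.
Qed.

(** The factor 2 sech^2 - 1 changes sign when sech^2 passes from 1 - t1^2 to t1^2. *)
Lemma dsol_vertex j : dsol s L (shift j) L =
  s * (1 - 2 * t1 ^+ 2) * (if (j < n)%N then u else - t1).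
Proof.
rewrite /dsol sechv_vertex; case: ifP => _; last by ring.
by rewrite u2; ring.
Qed.

Lemma potentialE j x : omega - 3 * profile L omega (shift j) x ^+ 2 =
  s ^+ 2 * (1 - 6 * sechv s L (shift j) x ^+ 2).
Proof.
rewrite /profile -/s -/(sechv s L (shift j) x) exprMn.
rewrite [Num.sqrt (2 * omega) ^+ 2]sqr_sqrtr ?mulr_ge0 ?(ltW omega0)//.
by rewrite [s ^+ 2]sqr_sqrtr ?(ltW omega0)//; ring.
Qed.

Let ReM (x : R) (z : R[i]) : complex.Re (x%:C * z) = x * complex.Re z.
Proof. by case: z => a b /=; rewrite mul0r subr0. Qed.

Let ImM (x : R) (z : R[i]) : complex.Im (x%:C * z) = x * complex.Im z.
Proof. by case: z => a b /=; rewrite mul0r addr0. Qed.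

Let complexP (z w : R[i]) :
  complex.Re z = complex.Re w -> complex.Im z = complex.Im w -> z = w.
Proof. by case: z w => [a b] [c d] /= -> ->. Qed.

Let ReD (z w : R[i]) : complex.Re (z + w) = complex.Re z + complex.Re w.
Proof. by case: z w => [a b] [c d]. Qed.

Let ImD (z w : R[i]) : complex.Im (z + w) = complex.Im z + complex.Im w.
Proof. by case: z w => [a b] [c d]. Qed.

Let ReN (z : R[i]) : complex.Re (- z) = - complex.Re z. Proof. by case: z. Qed.

Let ImN (z : R[i]) : complex.Im (- z) = - complex.Im z. Proof. by case: z. Qed.

(** The real factors found for the real and imaginary parts form one complex coefficient per edge.
    Together with [sol_Ker_Lplus], this reduces the kernel to a finite linear system in c and d. *)
Lemma Ker_Lplus_sol psi : Ker_Lplus (N := N) n L Z omega t1 psi ->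
  exists (c : 'I_N -> R[i]) (d : R[i]),
  [/\ forall j, half_line_ae_eq L (psi j)
        (fun x => (sol s L (shift j) x)%:C * c j),
      forall j, d = (dsol s L (shift j) L)%:C * c j &
      \sum_(j < N) (sol s L (shift j) L)%:C * c j = Z%:C * d].
Proof.
move=> [dpsi [ddpsi [[H2psi [v [d [psiv psid sumv]]]] eqpsi]]].
have comp j : exists c : R[i],
    [/\ half_line_ae_eq L (psi j) (fun x => (sol s L (shift j) x)%:C * c),
      v j = (sol s L (shift j) L)%:C * c & d = (dsol s L (shift j) L)%:C * c].
  have [[rf imf] [rdf imdf] [rddf imddf] [rw imw] [rdw imdw]] := H2psi j.
  have [rtr imtr] := psiv j.
  have [rdtr imdtr] := psid j.
  have eqRe : half_line_ae_eq L (fun x => complex.Re (ddpsi j x))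
      (fun x => s ^+ 2 * (1 - 6 * sechv s L (shift j) x ^+ 2) *
         complex.Re (psi j x)).
    apply: ae_half_lineS (eqpsi j) => x _ /(congr1 (@complex.Re _)).
    rewrite /= ReD ReN potentialE ReM addrC => /eqP.
    by rewrite eq_sym subr_eq0 => /eqP.
  have eqIm : half_line_ae_eq L (fun x => complex.Im (ddpsi j x))
      (fun x => s ^+ 2 * (1 - 6 * sechv s L (shift j) x ^+ 2) *
         complex.Im (psi j x)).
    apply: ae_half_lineS (eqpsi j) => x _ /(congr1 (@complex.Im _)).
    rewrite /= ImD ImN potentialE ImM addrC => /eqP.
    by rewrite eq_sym subr_eq0 => /eqP.
  have aj0 := profile_shift_gt0 j.
  have [a [psia va da]] :=
    kernel_component s0 aj0 rf rdf rddf rw rdw eqRe rtr rdtr.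
  have [b [psib vb db]] :=
    kernel_component s0 aj0 imf imdf imddf imw imdw eqIm imtr imdtr.
  exists (a +i* b); split.
  - apply: ae_half_lineS2 psia psib => x _ ea eb.
    by apply: complexP; rewrite ?ReM ?ImM /= mulrC.
  - by apply: complexP; rewrite ?ReM ?ImM /= mulrC.
  - by apply: complexP; rewrite ?ReM ?ImM /= mulrC.
have [c cE] := choice comp.
exists c, d; split; first by move=> j; case: (cE j).
  by move=> j; case: (cE j).
by rewrite -sumv; apply: eq_bigr => j _; case: (cE j).
Qed.

Let real_L2_scale (f : R -> R) (k : R) : real_L2 L f ->
  real_L2 L (fun x => f x * k).
Proof.
rewrite /real_L2 => fL; have := Lfun_scale k (ler1n R 2) fL.
have -> // : k \o* (f \_ (half_line L)) = (fun x => f x * k) \_ (half_line L).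
by apply/funext => x; rewrite /= !patchE; case: ifP => //= _; rewrite mul0r.
Qed.

Let weak_scale (f df : R -> R) (k : R) :
  (forall x : R, is_derive x 1 f (df x)) ->
  continuous df ->
  real_weak_derivative L (fun x => f x * k) (fun x => df x * k).
Proof.
move=> fdf cdf; apply: weak_derivative_of_derive => x.
  apply: (is_derive_eq (is_deriveM (fdf x) (is_derive_cst k x 1))).
  by rewrite /GRing.scale/= mulr0 add0r mulrC.
by apply: cvgM; [exact: cdf|exact: cvg_cst].
Qed.

Let trace_scale (f : R -> R) (k : R) : continuous f ->
  real_trace L (fun x => f x * k) (f L * k).
Proof.
move=> cf; apply: (@real_trace_continuous _ L (fun x => f x * k)) => x.
by apply: cvgM; [exact: cf|exact: cvg_cst].
Qed.

Lemma sol_Ker_Lplus (c : 'I_N -> R[i]) (d : R[i]) :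
  (forall j, d = (dsol s L (shift j) L)%:C * c j) ->
  \sum_(j < N) (sol s L (shift j) L)%:C * c j = Z%:C * d ->
  Ker_Lplus (N := N) n L Z omega t1
    (fun j x => (sol s L (shift j) x)%:C * c j).
Proof.
move=> dc sumc.
exists (fun j x => (dsol s L (shift j) x)%:C * c j).
exists (fun j x => (ddsol s L (shift j) x)%:C * c j).
have ReE (f : R -> R) z : (fun x => complex.Re ((f x)%:C * z)) =
    (fun x => f x * complex.Re z) by apply/funext => x; rewrite ReM.
have ImE (f : R -> R) z : (fun x => complex.Im ((f x)%:C * z)) =
    (fun x => f x * complex.Im z) by apply/funext => x; rewrite ImM.
split; last first.
  move=> j; apply: aeW => x _; rewrite potentialE /graph_zero /ddsol.
  by rewrite rmorphM mulrA addNr.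
split.
  move=> j; split; split; rewrite ?ReE ?ImE.
  - by apply: real_L2_scale; exact: real_L2_sol.
  - by apply: real_L2_scale; exact: real_L2_sol.
  - by apply: real_L2_scale; exact: real_L2_dsol.
  - by apply: real_L2_scale; exact: real_L2_dsol.
  - by apply: real_L2_scale; exact: real_L2_ddsol.
  - by apply: real_L2_scale; exact: real_L2_ddsol.
  - by apply: weak_scale; [exact: is_derive_sol|exact: continuous_dsol].
  - by apply: weak_scale; [exact: is_derive_sol|exact: continuous_dsol].
  - by apply: weak_scale; [exact: is_derive_dsol|exact: continuous_ddsol].
  - by apply: weak_scale; [exact: is_derive_dsol|exact: continuous_ddsol].
exists (fun j => (sol s L (shift j) L)%:C * c j), d; split => // j.
- split; rewrite ?ReE ?ImE ?ReM ?ImM; apply: trace_scale; exact: continuous_sol.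
- rewrite (dc j).
  split; rewrite ?ReE ?ImE ?ReM ?ImM; apply: trace_scale; exact: continuous_dsol.
Qed.

End star_kernel.

(** * Solving the vertex system *)

Section star_kernel_dimension.
Context {R : realType}.
Notation mu := (@lebesgue_measure R).
Local Open Scope classical_set_scope.
Local Open Scope complex_scope.

Lemma real_complex_eq0 (x : R) : (x%:C == 0) = (x == 0).
Proof. by rewrite eq_complex /= eqxx andbT. Qed.

(** The half-line is not negligible; this extracts scalar identities from almost everywhere ones. *)
Lemma ae_half_line_cst (L : R) (P : Prop) :
  (\forall x \ae mu, half_line L x -> P) -> P.
Proof.
move=> aeP; apply: contrapT => nP.
have muL : mu (half_line L) = +oo%E.
  by rewrite /half_line lebesgue_measure_itv/= ltry.
have mL : measurable (half_line L : set (measurableTypeR R)).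
  exact: measurable_half_line.
suff /(negligibleP mu mL) : mu.-negligible (half_line L) by rewrite [LHS]muL.
by apply: negligibleS aeP => x Lx /(_ Lx).
Qed.

(** The kernel is a set of representatives, so functions that are nonzero on a null set must be
    covered; the zero function serves as both derivatives. *)
Lemma L2_zero_sub_Ker (N n : nat) (L Z omega t1 : R) psi :
  L2_zero (N := N) L psi -> Ker_Lplus (N := N) n L Z omega t1 psi.
Proof.
move=> [psiL psi0].
have L20 : real_L2 L (fun=> 0 : R).
  rewrite /real_L2 (_ : _ \_ _ = cst 0); last first.
    by apply/funext => x; rewrite patchE if_same.
  apply: Lfun2_of_integrable; first exact: measurable_cst.
  by apply: eq_integrable (integrable0 mu setT) => // x _; rewrite /= expr0n.
have int0 (f : R -> R) : \int[mu]_(x in half_line L) (0 * f x) = 0.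
  rewrite /Rintegral integral0_eq// => x _; by rewrite mul0r.
have w0 (f : R -> R) : real_L2 L f -> half_line_ae_eq L f (fun=> 0) ->
    real_weak_derivative L f (fun=> 0).
  move=> fL f0 phi [_ cdphi _]; rewrite int0 oppr0 -(int0 (derive1 phi)).
  apply: Rintegral_ae_eq.
  - apply: measurable_funM; first exact: real_L2_measurable.
    exact: continuous_measurable.
  - apply: measurable_funM; first exact: measurable_cst.
    exact: continuous_measurable.
  - by apply: ae_half_lineS f0 => x _ ->.
have tr0 (f : R -> R) : half_line_ae_eq L f (fun=> 0) -> real_trace L f 0.
  move=> f0; exists (fun=> 0); split => //.
  by apply: continuous_subspaceT => x; exact: cvg_cst.
exists (fun _ _ => 0), (fun _ _ => 0); split; last first.
  by move=> j; apply: ae_half_lineS (psi0 j) => x _ ->; rewrite mulr0 oppr0 addr0.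
split.
  move=> j; have [rL iL] := psiL j.
  split=> //; split; apply: w0 => //; try exact: aeW.
    by apply: ae_half_lineS (psi0 j) => x _ ->.
  by apply: ae_half_lineS (psi0 j) => x _ ->.
exists (fun=> 0), 0; split.
- by move=> j; split; apply: tr0; apply: ae_half_lineS (psi0 j) => x _ ->.
- by move=> j; split; apply: tr0; apply: aeW.
- by rewrite big1// mulr0.
Qed.

Section parameters.
Variables (N n : nat) (L Z omega t1 p q u : R).
Hypotheses (omega0 : 0 < omega) (t1_01 : 0 < t1 < 1).
Hypotheses (nN : (n <= N)%N) (p0 : 0 < p) (q0 : 0 < q) (u0 : 0 < u).
Hypotheses (np : n%:R = p ^+ 3) (mq : (N - n)%N%:R = q ^+ 3).
Hypotheses (uE : Num.sqrt (1 - t1 ^+ 2) = u) (tu : t1 ^+ 2 + u ^+ 2 = 1).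
Hypotheses (qt : q * t1 < p * u).
Hypotheses (Z0 : Z < 0) (halpha : alpha N n t1 = - Z * Num.sqrt omega).

Let s := Num.sqrt omega.
Let shift (j : 'I_N) := profile_shift n t1 j.
(** Up to a nonzero factor, the derivative of [sol] at the vertex; its vanishing separates the two
    cases. *)
Let kappa := 1 - 2 * t1 ^+ 2.

Let t0 : 0 < t1. Proof. by case/andP: t1_01. Qed.
Let s0 : 0 < s. Proof. by rewrite sqrtr_gt0. Qed.

Let XE : p ^+ 3 / t1 + q ^+ 3 / u = - Z * s.
Proof. by rewrite -halpha /alpha np mq uE. Qed.

Let NE : N%:R = p ^+ 3 + q ^+ 3.
Proof. by rewrite -np -mq -natrD subnKC. Qed.

Let qp_n : (q < p) = (N < 2 * n)%N.
Proof.
rewrite -(ltr_nat R) natrM NE np -[LHS](@ltr_pXn2r _ 3)// ?nnegrE ?ltW//.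
by apply/idP/idP; lra.
Qed.

(** If it vanishes, t1 = u, so q t1 < p u gives q < p, and [alpha] equals N / t1, whose square is 2
    N^2. The converse is [alpha_eq_midpoint]. *)
Lemma kappa_eq0 :
  kappa = 0 <-> (N < 2 * n)%N /\ omega = 2 * N%:R ^+ 2 / Z ^+ 2.
Proof.
have Z2 : Z ^+ 2 != 0 by rewrite expf_neq0// lt_eqF.
have X2 : (- Z * s) ^+ 2 = Z ^+ 2 * omega.
  by rewrite exprMn sqrrN sqr_sqrtr// ltW.
split.
  rewrite /kappa => k0.
  have tu' : t1 = u.
    apply/eqP; rewrite -(@eqrXn2 _ 2) ?ltW//; apply/eqP; move: tu k0; lra.
  split; first by rewrite -qp_n; move: qt; rewrite -tu' ltr_pM2r.
  apply: (@mulIf _ (Z ^+ 2)) => //; rewrite divfK// mulrC -X2 -XE -tu' -mulrDl -NE.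
  rewrite exprMn exprVn mulrC; congr (_ * _); apply/eqP.
  rewrite -(inj_eq invr_inj) invrK; apply/eqP; lra.
move=> [Nn om]; rewrite /kappa (alpha_eq_midpoint p0 q0 t0 u0 tu qt _ XE) ?subrr//.
  by rewrite qp_n.
by rewrite X2 om mulrC divfK// NE.
Qed.

Lemma Ker_Lplus_trivial : kappa != 0 ->
  Ker_Lplus (N := N) n L Z omega t1 = L2_zero (N := N) L.
Proof.
move=> k0; apply/seteqP; split; last by move=> psi; exact: L2_zero_sub_Ker.
move=> psi Kpsi; have [c [d [psiE dE sumE]]] := Ker_Lplus_sol omega0 t1_01 Kpsi.
split.
  by move: Kpsi => [dpsi [ddpsi [[H2psi _] _]]] j; case: (H2psi j).
have sk0 : s * kappa != 0 by rewrite mulf_neq0// gt_eqF.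
(* Multiplying by [s * kappa] expresses each summand of the vertex condition through d, without
   dividing. *)
have term j : (s * kappa)%:C * ((sol s L (shift j) L)%:C * c j) =
    if (j < n)%N then t1%:C * d else (- u)%:C * d.
  rewrite (dE j) dsol_vertex // sol_vertex// uE.
  by case: (j < n)%N; rewrite !mulrA -!rmorphM; congr (_%:C * _);
    rewrite /s /kappa; ring.
have d0 : d = 0.
  (* This is the summed vertex condition; the coefficient is nonzero by [vertex_condition_neq] with
     X = - Z s. *)
  have : (s * kappa * Z - (p ^+ 3 * t1 - q ^+ 3 * u))%:C * d = 0.
    have -> : (s * kappa * Z - (p ^+ 3 * t1 - q ^+ 3 * u))%:C =
        (s * kappa)%:C * Z%:C - ((p ^+ 3)%:C * t1%:C + (q ^+ 3)%:C * (- u)%:C).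
      by rewrite -!rmorphM -rmorphD -rmorphB mulrN.
    rewrite mulrBl -mulrA -sumE mulr_sumr (eq_bigr _ (fun j _ => term j)).
    rewrite sum_if_ltn// -[_ *+ n]mulr_natl -[_ *+ (N - n)]mulr_natl.
    rewrite -!(rmorph_nat (real_complex R)) np mq.
    by rewrite mulrDl !mulrA subrr.
  move/eqP; rewrite mulf_eq0 => /orP[|/eqP//].
  rewrite real_complex_eq0 subr_eq0 => /eqP e.
  have := vertex_condition_neq q0 t0 u0 tu qt XE.
  by rewrite -e => /eqP[]; rewrite /kappa; ring.
move=> j; apply: ae_half_lineS (psiE j) => x _ ->.
suff -> : c j = 0 by rewrite mulr0.
move: (dE j); rewrite d0 dsol_vertex// -/s -/kappa => /esym/eqP.
rewrite mulf_eq0 => /orP[|/eqP//]; rewrite real_complex_eq0 mulf_eq0.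
by rewrite (negPf sk0)/=; case: ifP; rewrite ?oppr_eq0 ?uE gt_eqF.
Qed.

End parameters.

Lemma Ker_Lplus_dim (M n : nat) (L Z omega t1 : R) :
  0 < omega -> 0 < t1 < 1 -> 2 * t1 ^+ 2 = 1 ->
  L2_dim L (Ker_Lplus (N := M.+1) n L Z omega t1) M.
Proof.
move=> omega0 t1_01 t2.
have t0 : 0 < t1 by case/andP: t1_01.
have ut : Num.sqrt (1 - t1 ^+ 2) = t1.
  by rewrite (_ : 1 - t1 ^+ 2 = t1 ^+ 2) ?sqrtr_sqr ?gtr0_norm//; lra.
pose s := Num.sqrt omega; have s0 : 0 < s by rewrite sqrtr_gt0.
pose a := arctanh t1; have a0 : 0 < a by exact: arctanh_gt0.
have shiftE (j : 'I_M.+1) : profile_shift n t1 j = a.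
  by rewrite /profile_shift ut if_same.
pose w := sol s L a.
have w0 x : L <= x -> 0 < w x by exact: sol_gt0.
have dw0 : dsol s L a L = 0.
  rewrite -(shiftE ord0) dsol_vertex//.
  by rewrite t2 subrr mulr0 mul0r.
have KerP (c : 'I_M.+1 -> R[i]) : \sum_(j < M.+1) c j = 0 ->
    Ker_Lplus (N := M.+1) n L Z omega t1 (fun j x => (w x)%:C * c j).
  move=> c0; have -> : (fun j x => (w x)%:C * c j) =
      (fun j x => (sol s L (profile_shift n t1 j) x)%:C * c j).
    by apply/funext => j; rewrite shiftE.
  apply: (sol_Ker_Lplus omega0 (d := 0)).
    by move=> j; rewrite shiftE dw0 mul0r.
  by under eq_bigr do rewrite shiftE; rewrite -mulr_sumr c0 !mulr0.
(* Basis of the hyperplane of zero sum: 1 on one edge, -1 on the last. On the other edges a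
   combination has its own coefficients as coordinates, which gives independence. *)
pose e (k : 'I_M) (j : 'I_M.+1) : R[i] :=
  (j == lift ord_max k)%:R - (j == ord_max)%:R.
have e_max k : e k ord_max = -1 by rewrite /e eqxx eq_liftF sub0r.
have e_lift k l : e k (lift ord_max l) = (k == l)%:R.
  rewrite /e (inj_eq lift_inj) [lift _ _ == ord_max]eq_sym eq_liftF subr0.
  by rewrite eq_sym.
have comb (c : 'I_M -> R[i]) j x :
    lincomb c (fun k j x => (w x)%:C * e k j) j x =
    (w x)%:C * \sum_(k < M) c k * e k j.
  by rewrite /lincomb mulr_sumr; apply: eq_bigr => k _; rewrite mulrCA.
have comb_lift (c : 'I_M -> R[i]) k :
    \sum_(l < M) c l * e l (lift ord_max k) = c k.
  rewrite (bigD1 k)//= e_lift eqxx mulr1 big1 ?addr0// => l lk.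
  by rewrite e_lift (negPf lk) mulr0.
exists (fun k j x => (w x)%:C * e k j); split.
- have delta (i : 'I_M.+1) : \sum_(j < M.+1) (j == i)%:R = 1 :> R[i].
    by rewrite (bigD1 i)//= eqxx big1 ?addr0// => j /negPf ->.
  by move=> k; apply: KerP; rewrite sumrB !delta subrr.
- move=> c c0 k; apply: (@ae_half_line_cst L).
  apply: ae_half_lineS (c0 (lift ord_max k)) => x Lx.
  rewrite comb comb_lift => /eqP; rewrite mulf_eq0 => /orP[|/eqP//].
  by rewrite real_complex_eq0 gt_eqF// w0.
- move=> psi /(Ker_Lplus_sol omega0 t1_01)[c [d [psiE dE sumE]]].
  exists (fun k => c (lift ord_max k)) => j.
  apply: ae_half_lineS (psiE j) => x Lx ->.
  rewrite comb shiftE; congr (_ * _).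
  have [k ->|->] := unliftP ord_max j; first by rewrite comb_lift.
  under eq_bigr do rewrite e_max mulrN1.
  (* The last coordinate is determined by the others: the common derivative is zero, so the vertex
     condition forces a zero sum. *)
  have sumc : \sum_(j < M.+1) c j = 0.
    move: sumE; rewrite (dE ord0) shiftE dw0 mul0r mulr0.
    under eq_bigr do rewrite shiftE.
    rewrite -mulr_sumr => /eqP; rewrite mulf_eq0 => /orP[|/eqP//].
    by rewrite real_complex_eq0 gt_eqF// w0.
  rewrite sumrN; apply/eqP; rewrite -addr_eq0; apply/eqP.
  rewrite -[RHS]sumc big_ord_recr/= addrC; congr (_ + _).
  by apply: eq_bigr => k _; congr c; apply/val_inj; exact: lift_max.
Qed.

End star_kernel_dimension.

Theorem proposition5p4 (R : realType) (L Z omega t1 : R) (N n : nat)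
    (hL : 0 <= L) (hZ : Z < 0) (hN : (2 <= N)%N)
    (hn : (1 <= n <= N - 1)%N)
    (homega : omega_star N n Z < omega)
    (ht1 : 0 < t1 < t_star R N n)
    (halpha : alpha N n t1 = - Z * Num.sqrt omega) :
  ((2 * n <= N)%N \/
   ((N < 2 * n)%N /\ omega <> 2 * N%:R ^+ 2 / Z ^+ 2) ->
     Ker_Lplus (N := N) n L Z omega t1 = L2_zero (N := N) L) /\
  ((N < 2 * n)%N /\ omega = 2 * N%:R ^+ 2 / Z ^+ 2 ->
     L2_dim L (Ker_Lplus (N := N) n L Z omega t1) (N - 1)%N).
Proof.
have omega0 : 0 < omega.
  by apply: le_lt_trans homega; rewrite divr_ge0 ?sqr_ge0.
have [p [q [u [[p0 q0 u0] np mq uE [tu qt]]]]] := t_star_lt hn ht1.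
have nN : (n <= N)%N by case/andP: hn => _ /leq_trans -> //; exact: leq_subr.
have t1_01 : 0 < t1 < 1.
  by case/andP: ht1 => -> _ /=; have := exprn_gt0 2 u0; nra.
have kE := @kappa_eq0 _ N n Z omega t1 p q u omega0 t1_01 nN p0 q0 u0 np mq
  uE tu qt hZ halpha.
split.
- move=> H; apply: (@Ker_Lplus_trivial _ N n L Z omega t1 p q u) => //.
  apply/eqP => /kE[Nn om]; case: H => [|[_ /(_ om)//]].
  by rewrite leqNgt Nn.
- move=> /kE k0; case: N hN {hn homega ht1 halpha mq nN kE} => // M _.
  by rewrite subn1; apply: Ker_Lplus_dim => //; lra.
Qed.
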